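(* Let $M$ be a submonoid of $(\mathbb{N},+)$. Then $M$ is a Coe-monoid if and only if either $M\subseteq\langle 2\rangle=\{2k\mid k\in\mathbb{N}\}$ or $M$ is a Coe-semigroup.
   Context: $\mathbb{N}=\{0,1,2,\ldots\}$. A submonoid of $(\mathbb{N},+)$ is a subset of $\mathbb{N}$ containing $0$ and closed under addition; it is a numerical semigroup if its complement in $\mathbb{N}$ is finite. A numerical semigroup $S$ is a Coe-semigroup if $\{x-1,x+1\}\subseteq S$ for every odd $x\in S$. A Coe-monoid is a submonoid of $(\mathbb{N},+)$ that can be expressed as an intersection of a (finite or infinite) family of Coe-semigroups. *)

(* Defs.v *)
From mathcomp Require Import all_boot.
From mathcomp Require Import boolp classical_sets cardinality.

Set Implicit Arguments.
Unset Strict Implicit.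
Unset Printing Implicit Defensive.

Local Open Scope classical_set_scope.

Definition is_submonoid (M : set nat) : Prop :=
  M 0 /\ forall x y : nat, M x -> M y -> M (x + y).

Definition is_numerical_semigroup (S : set nat) : Prop :=
  is_submonoid S /\ finite_set (~` S).

(* Truncated subtraction is harmless here: an odd x is at least 1. *)
Definition is_Coe_semigroup (S : set nat) : Prop :=
  is_numerical_semigroup S /\
  forall x : nat, odd x -> S x -> [set x - 1; x + 1] `<=` S.

(* The family is arbitrary. The empty one has intersection setT, which is also
   the intersection of the singleton family {setT}, as setT is itself a
   Coe-semigroup; so allowing the empty family changes nothing. *)
Definition is_Coe_monoid (M : set nat) : Prop :=
  is_submonoid M /\
  exists F : set (set nat),
    (forall S : set nat, F S -> is_Coe_semigroup S) /\
    M = \bigcap_(S in F) S.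

(* Main.v *)
(* If a Coe-monoid contains an odd x, it also contains x + 1, and
   the consecutive elements x, x + 1 generate every n >= x^2.  Conversely, for
   M made of even numbers, M is the intersection of the Coe-semigroups
   M `|` [2k, oo[, whose odd elements all exceed 2k. *)
Require Import Defs.
From mathcomp Require Import all_boot.
From mathcomp Require Import boolp classical_sets cardinality.

Local Open Scope classical_set_scope.

Lemma submonoid_mul (M : set nat) (n x : nat) :
  is_submonoid M -> M x -> M (n * x).
Proof.
move=> [M0 MD] Mx; elim: n => [|n IHn]; first by rewrite mul0n.
by rewrite mulSn; exact: MD.
Qed.

Lemma finite_setC_tail (S : set nat) (m : nat) :
  (forall n, m <= n -> S n) -> finite_set (~` S).
Proof.
move=> Sm; apply: (sub_finite_set _ (finite_II m)) => n /= nSn.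
by rewrite ltnNge; apply/negP => /Sm.
Qed.

(** Divide: [n = q * x + r] with [r < x]. Since [x * x <= n] forces [x <= q], [r] of the [q] copies
    of [x] can each absorb one unit of the remainder, giving [n = (q - r) * x + r * x.+1]. *)
Lemma submonoid_consecutive (M : set nat) (x : nat) :
  is_submonoid M -> 0 < x -> M x -> M x.+1 -> forall n, x * x <= n -> M n.
Proof.
move=> Mmon x0 Mx Mx1 n xxn.
have rq : n %% x <= n %/ x.
  by rewrite ltnW// (leq_trans (ltn_pmod n x0))// leq_divRL.
have -> : n = (n %/ x - n %% x) * x + (n %% x) * x.+1.
  by rewrite mulnS addnCA -mulnDl subnK// addnC -divn_eq.
by case: (Mmon) => _; apply; exact: submonoid_mul.
Qed.

Lemma Coe_semigroup_tail (M : set nat) (k : nat) :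
  is_submonoid M -> M `<=` [set 2 * j | j in [set: nat]] ->
  is_Coe_semigroup (M `|` [set n | 2 * k <= n]).
Proof.
move=> [M0 MD] Meven; split; first split.
- split; first by left.
  move=> x y [Mx|/= kx] [My|/= ky]; first (by left; exact: MD); right => /=.
  + exact: leq_trans ky (leq_addl _ _).
  + exact: leq_trans kx (leq_addr _ _).
  + exact: leq_trans kx (leq_addr _ _).
- by apply: (finite_setC_tail _ (2 * k)) => n kn; right.
- move=> x xodd [/Meven[j _ jx]|/= kx]; first by rewrite -jx mul2n odd_double in xodd.
  (* The threshold is even and [x] is odd, so the inequality is strict; hence [x - 1] does not fall
     out of the tail. *)
  have kx' : 2 * k < x.
    by rewrite ltn_neqAle kx andbT; apply: contraTneq xodd => <-; rewrite mul2n odd_double.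
  move=> _ [->|->]; right => /=; last exact: leq_trans kx (leq_addr _ _).
  by rewrite subn1 -ltnS (ltn_predK kx').
Qed.

Theorem corollary34 (M : set nat) (hM : is_submonoid M) :
  is_Coe_monoid M <->
  (M `<=` [set 2 * k | k in [set: nat]] \/ is_Coe_semigroup M).
Proof.
split=> [[_ [F [FCoe MF]]]|[Meven|MCoe]].
(* Unlike cofiniteness, this closure passes to arbitrary intersections. *)
- have Mclosed x : odd x -> M x -> [set x - 1; x + 1] `<=` M.
    move=> xodd; rewrite MF => Mx y xy S FS.
    by case: (FCoe S FS) => _ /(_ x xodd (Mx S FS)); apply.
  have [|/existsNP[x /not_implyP[Mx xeven]]] :=
    pselect (M `<=` [set 2 * k | k in [set: nat]]); first by left.
  have xodd : odd x.
    apply: contra_notT xeven => xeven; exists x./2 => //.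
    by rewrite mul2n even_halfK.
  right; split=> //; split=> //; apply: (finite_setC_tail _ (x * x)).
  apply: submonoid_consecutive => //; first exact: odd_gt0.
  by rewrite -addn1; apply: (Mclosed x) => //; right.
- split=> //; exists (range (fun k => M `|` [set n | 2 * k <= n])).
  split=> [_ [k _ <-]|]; first exact: Coe_semigroup_tail.
  apply/seteqP; split=> [n Mn _ [k _ <-]|n]; first by left.
  (* The tail from [2 * n.+1] starts beyond [n], so [n] can lie in this member of the family only
     through [M]. *)
  move=> /(_ (M `|` [set m | 2 * n.+1 <= m])) [|//|/=]; first by exists n.+1.
  by rewrite leqNgt mul2n -addnn ltn_addr.
- split=> //; exists [set M]; split=> [_ ->//|].
  by rewrite bigcap_set1.
Qed.
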